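(* Suppose that $\widehat{\mathcal{Q}}=\mathcal{Q}+\mathrm{Diag}(\mathcal{D}_1,\mathcal{D}_2)$ for some self-adjoint positive semidefinite linear operators $\mathcal{D}_1:\mathbb{U}\to\mathbb{U}$ and $\mathcal{D}_2:\mathbb{V}\to\mathbb{V}$, that $\widehat{\mathcal{Q}}_{11}=\mathcal{Q}_{11}+\mathcal{D}_1\succ 0$ and $\widehat{\mathcal{Q}}_{22}=\mathcal{Q}_{22}+\mathcal{D}_2\succ 0$, and that the set $\Omega$ of minimizers of $\theta$ is nonempty. Let $w^*\in\Omega$. Assume that $\sum_{i=1}^{\infty} i\,\varepsilon_i<\infty$. Then there is a positive scalar $c_0$, independent of $k$, such that the sequence $\{\widetilde{w}^k\}=\{(\widetilde{u}^k,\widetilde{v}^k)\}$ generated by the imABCD algorithm satisfies $$\theta(\widetilde{w}^k)-\theta(w^* )\;\leq\;\frac{2\,\|\widetilde{w}^0-w^*\|_{\mathcal{H}}^2+c_0}{(k+1)^2},\qquad \forall\, k\geq 1.$$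
   Context: Problem. $\mathbb{U}=\mathbb{U}_1\times\mathbb{U}_2$ and $\mathbb{V}=\mathbb{V}_1\times\mathbb{V}_2$ are finite dimensional Euclidean spaces; write $w=(u,v)\in\mathbb{U}\times\mathbb{V}$ with $u=(u_1,u_2)$, $v=(v_1,v_2)$. The problem is to minimize $\theta(w)=h(w)+p(u)+q(v)$, where $h:\mathbb{U}\times\mathbb{V}\to\mathbb{R}$ is convex and differentiable with globally Lipschitz continuous gradient, and $p(u)=\varphi_1(u_1)+\varphi_2(u_2)$, $q(v)=\varphi_3(v_1)+\varphi_4(v_2)$ with $\varphi_1,\dots,\varphi_4$ proper closed convex functions with values in $(-\infty,+\infty]$. $\Omega$ denotes the set of minimizers of $\theta$. Majorization. $\mathcal{Q},\widehat{\mathcal{Q}}:\mathbb{U}\times\mathbb{V}\to\mathbb{U}\times\mathbb{V}$ are self-adjoint positive semidefinite linear operators such that for all $w,w'\in\mathbb{U}\times\mathbb{V}$, $$h(w)\geq h(w')+\langle\nabla h(w'),w-w'\rangle+\tfrac12\|w-w'\|_{\mathcal{Q}}^2,\qquad h(w)\leq \widehat{h}(w;w'):=h(w')+\langle\nabla h(w'),w-w'\rangle+\tfrac12\|w-w'\|_{\widehat{\mathcal{Q}}}^2,$$ where $\|x\|_{\mathcal{T}}^2=\langle x,\mathcal{T}x\rangle$ for a self-adjoint positive semidefinite $\mathcal{T}$. Block forms with respect to $\mathbb{U}\times\mathbb{V}$: $\mathcal{Q}=\begin{pmatrix}\mathcal{Q}_{11}&\mathcal{Q}_{12}\\ \mathcal{Q}_{12}^*&\mathcal{Q}_{22}\end{pmatrix}$,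 $\widehat{\mathcal{Q}}=\begin{pmatrix}\widehat{\mathcal{Q}}_{11}&\widehat{\mathcal{Q}}_{12}\\ \widehat{\mathcal{Q}}_{12}^*&\widehat{\mathcal{Q}}_{22}\end{pmatrix}$. Define $\mathcal{H}=\mathrm{Diag}(\mathcal{D}_1,\mathcal{D}_2+\mathcal{Q}_{22})$ on $\mathbb{U}\times\mathbb{V}$. imABCD algorithm. Choose $w^1=(u^1,v^1)=\widetilde{w}^0=(\widetilde{u}^0,\widetilde{v}^0)\in\mathrm{dom}\,p\times\mathrm{dom}\,q$, a nonnegative non-increasing sequence $\{\varepsilon_k\}_{k\geq1}$, and $t_1=1$. For $k\geq1$, writing $w^k=(u^k,v^k)$, compute $$\widetilde{u}^k=\operatorname*{argmin}_{u\in\mathbb{U}}\{p(u)+\widehat{h}(u,v^k;w^k)+\langle\delta_u^k,u\rangle\},\qquad \widetilde{v}^k=\operatorname*{argmin}_{v\in\mathbb{V}}\{q(v)+\widehat{h}(\widetilde{u}^k,v;w^k)+\langle\delta_v^k,v\rangle\},$$ where the errors $(\delta_u^k,\delta_v^k)\in\mathbb{U}\times\mathbb{V}$ satisfy $\max\{\|\widehat{\mathcal{Q}}_{11}^{-1/2}\delta_u^k\|,\|\widehat{\mathcal{Q}}_{22}^{-1/2}\delta_v^k\|\}\leq\varepsilon_k$; set $\widetilde{w}^k=(\widetilde{u}^k,\widetilde{v}^k)$, and then $$t_{k+1}=\tfrac12\Bigl(1+\sqrt{1+4t_k^2}\Bigr),\qquad w^{k+1}=\widetilde{w}^k+\frac{t_k-1}{t_{k+1}}(\widetilde{w}^k-\widetilde{w}^{k-1}).$$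 *)

(* Defs.v *)
From HB Require Import structures.
From mathcomp Require Import all_boot all_order all_algebra.
From mathcomp Require Import all_classical all_reals all_analysis.
Set Implicit Arguments.
Unset Strict Implicit.
Unset Printing Implicit Defensive.
Import Order.TTheory GRing.Theory Num.Theory.
Import numFieldNormedType.Exports.
Local Open Scope classical_set_scope.
Local Open Scope ring_scope.

HB.mixin Record Lmodule_hasDot (R : realType) E of GRing.Lmodule R E := {
  dotp : {dot E for (@idfun R)} }.

#[short(type="innerType")]
HB.structure Definition Inner (R : realType) :=
  { E of Lmodule_hasDot R E & GRing.Lmodule R E }.

HB.mixin Record Inner_isEuclidean (R : realType) E
    of NormedModule R E & Inner R E := {
  sqr_norm_dotp : forall x : E, `|x| ^+ 2 = dotp x x }.

#[short(type="euclideanType")]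
HB.structure Definition Euclidean (R : realType) :=
  { E of Inner_isEuclidean R E & Inner R E & NormedModule R E & Vector R E }.

(* A product of Euclidean spaces carries the inner product below, but its
   library norm is the max norm; that norm is used only for its topology, which
   is the Euclidean one.  Euclidean lengths are measured with enorm. *)
Section ProdDot.
Context {R : realType} {E F : innerType R}.

Definition prod_dot (x y : E * F) : R := dotp x.1 y.1 + dotp x.2 y.2.

Fact prod_dot_bilinear :
  bilinear_for (GRing.Scale.Law.clone _ _ *%R _)
    (GRing.Scale.Law.clone _ _ (@idfun R \; *%R) _) prod_dot.
Proof.
split=> [y|x] a ? ?; rewrite /prod_dot /=.
- by rewrite !linearPl mulrDr addrACA.
- by rewrite !linearPr /= mulrDr addrACA.
Qed.

HB.instance Definition _ :=
  bilinear_isBilinear.Build R _ _ _ _ _ prod_dot prod_dot_bilinear.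

Fact prod_dot_sym x y : prod_dot x y = (-1) ^+ false * idfun (prod_dot y x).
Proof.
rewrite /prod_dot /= expr0 mul1r; congr (_ + _);
  by rewrite [LHS]hermitian_subproof /= expr0 mul1r.
Qed.

HB.instance Definition _ :=
  isHermitianSesquilinear.Build R _ _ _ prod_dot prod_dot_sym.

Fact prod_dot_gt0 x : x != 0 -> 0 < prod_dot x x.
Proof.
have dotp_ge0 (G : innerType R) (z : G) : 0 <= dotp z z.
  have [->|z0] := eqVneq z 0; first by rewrite linear0r.
  exact/ltW/neq0_dnorm_gt0.
case: x => x y; rewrite /prod_dot /=; have [->|x0 _] := eqVneq x 0.
  rewrite xpair_eqE eqxx /= linear0r add0r; exact: neq0_dnorm_gt0.
by rewrite ltr_pwDl ?neq0_dnorm_gt0.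
Qed.

HB.instance Definition _ := isDotProduct.Build R _ prod_dot prod_dot_gt0.

HB.instance Definition _ := Lmodule_hasDot.Build R (E * F)%type prod_dot.
End ProdDot.

Section Operators.
Context {R : realType}.
Implicit Types E F : innerType R.

Definition enorm E (x : E) : R := Num.sqrt (dotp x x).

Definition self_adjoint E (T : E -> E) := forall x y, dotp (T x) y = dotp x (T y).

Definition psd E (T : E -> E) := self_adjoint T /\ forall x, 0 <= dotp x (T x).

Definition pd E (T : E -> E) :=
  self_adjoint T /\ forall x, x != 0 -> 0 < dotp x (T x).

Definition sqnorm_op E (T : E -> E) (x : E) : R := dotp x (T x).

(* S = T^{-1/2}: the positive semidefinite S whose square is the inverse of T. *)
Definition inv_sqrt_of E (T S : E -> E) :=
  [/\ psd S, cancel T (S \o S) & cancel (S \o S) T].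

Definition block11 E F (T : E * F -> E * F) (x : E) : E := (T (x, 0)).1.
Definition block22 E F (T : E * F -> E * F) (y : F) : F := (T (0, y)).2.

Definition Diag E F (A : E -> E) (B : F -> F) (z : E * F) : E * F :=
  (A z.1, B z.2).
End Operators.

Section Functions.
Context {R : realType}.

Definition proper (X : Type) (f : X -> \bar R) :=
  (forall x, f x != -oo%E) /\ exists x, (f x < +oo)%E.

(* Meant for f that never takes the value -oo; note 0 * +oo = 0 in \bar R. *)
Definition convex_ereal (E : lmodType R) (f : E -> \bar R) :=
  forall (x y : E) (t : R), 0 <= t <= 1 ->
    (f (t *: x + (1 - t) *: y)%R <= t%:E * f x + (1 - t)%:E * f y)%E.

Definition proper_closed_convex (E : euclideanType R) (f : E -> \bar R) :=
  [/\ proper f, lower_semicontinuous f & convex_ereal f].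

Definition argmin (X : Type) (f : X -> \bar R) : set X :=
  [set x | forall y, (f x <= f y)%E].

Definition sep_sum (X Y : Type) (f : X -> \bar R) (g : Y -> \bar R) (z : X * Y)
  : \bar R := (f z.1 + g z.2)%E.
End Functions.

Section Problem.
Context {R : realType} {U1 U2 V1 V2 : euclideanType R}.
Local Notation U := (U1 * U2)%type.
Local Notation V := (V1 * V2)%type.
Local Notation W := (U * V)%type.

(* g is the gradient of h, i.e. the Riesz representative of its differential. *)
Definition gradient_of (h : W -> R) (g : W -> W) :=
  forall w, differentiable h w /\ forall d, 'd h w d = dotp (g w) d.

Definition theta (h : W -> R) (p : U -> \bar R) (q : V -> \bar R) (w : W)
  : \bar R := ((h w)%:E + p w.1 + q w.2)%E.

Definition quad_model (h : W -> R) (g T : W -> W) (w w' : W) : R :=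
  h w' + dotp (g w') (w - w') + 2^-1 * sqnorm_op T (w - w').

(* t k, w k, eps k, du k, dv k are meaningful for k >= 1 only, wt k for k >= 0.
   S1, S2 stand for the inverse square roots of the diagonal blocks of Qhat. *)
Record imABCD (p : U -> \bar R) (q : V -> \bar R) (hhat : W -> W -> R)
    (S1 : U -> U) (S2 : V -> V) (eps t : nat -> R)
    (du : nat -> U) (dv : nat -> V) (w wt : nat -> W) : Prop := IMABCD {
  imABCD_init : w 1%N = wt 0%N;
  imABCD_dom : (p (wt 0%N).1 < +oo)%E /\ (q (wt 0%N).2 < +oo)%E;
  imABCD_eps_ge0 : forall k, (1 <= k)%N -> 0 <= eps k;
  imABCD_eps_noninc : forall k, (1 <= k)%N -> eps k.+1 <= eps k;
  imABCD_t1 : t 1%N = 1;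
  imABCD_u : forall k, (1 <= k)%N ->
    (wt k).1 \in argmin (fun u : U =>
      (p u + (hhat (u, (w k).2) (w k) + dotp (du k) u)%:E)%E);
  imABCD_v : forall k, (1 <= k)%N ->
    (wt k).2 \in argmin (fun v : V =>
      (q v + (hhat ((wt k).1, v) (w k) + dotp (dv k) v)%:E)%E);
  imABCD_err : forall k, (1 <= k)%N ->
    Num.max (enorm (S1 (du k))) (enorm (S2 (dv k))) <= eps k;
  imABCD_t : forall k, (1 <= k)%N ->
    t k.+1 = 2^-1 * (1 + Num.sqrt (1 + 4 * t k ^+ 2));
  imABCD_w : forall k, (1 <= k)%N ->
    w k.+1 = wt k + ((t k - 1) / t k.+1) *: (wt k - wt k.-1) }.
End Problem.

(* Main.v *)
Require Import Defs.
From mathcomp Require Import all_boot all_order all_algebra.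
From mathcomp Require Import all_classical all_reals all_analysis.
From mathcomp Require Import ring lra.
Set Implicit Arguments.
Unset Strict Implicit.
Unset Printing Implicit Defensive.
Import Order.TTheory GRing.Theory Num.Theory.
Import numFieldNormedType.Exports.
Local Open Scope classical_set_scope.
Local Open Scope ring_scope.

(** The first-order optimality conditions of the two subproblems, combined with
    the quadratic minorant of [h] at the target point and its quadratic majorant
    at the new iterate, give for every [z] in the domain
      theta y + |z - y|_H^2 / 2 + |(z_u - y_u, z_v - x_v)|_Q^2 / 2
        <= theta z + |z - x|_H^2 / 2 + <d, z - y>,
    where [y] is the inexact block step from [x] with error [d]
    ([step_descent]).  The optimality conditions are used only in the form of a
    variational inequality, obtained by moving from the minimizer towards
    [z] ([argmin_variation]); that the cross terms between the two
    blocks assemble into the third square is [block_descent_identity].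

    As in every accelerated proximal scheme, the estimate is applied at
    z = ((t_k - 1) wt_{k-1} + w* ) / t_k and multiplied by t_k^2.  With
      X_k = t_k w_k - (t_k - 1) wt_{k-1} - w* ,
    the extrapolation rule makes X_{k+1} = t_k wt_k - (t_k - 1) wt_{k-1} - w* ,
    so the energy
      E_k = t_k^2 (theta wt_k - theta w* ) + |X_{k+1}|_H^2 / 2
    (with no objective gap when k = 0) satisfies E_k + P_k <= E_{k-1} + error,
    where P_k >= 0 is half the extra [Q]-square and the error is t_k times the
    inner product of [d] with -X_{k+1}.

    The error is controlled by eps_k and by the lengths of the blocks of X_{k+1}
    for the diagonal blocks of [Qhat].  The first of these lengths is not bounded
    by the [H]-length, since [D1] may be degenerate; here the square P_k is
    needed ([sqnorm_block11_le]).  The outcome is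
      F <= e + 4 t_k eps_k sqrt (F + e),  F = E_k + P_k, e = E_{k-1},
    hence sqrt E_k <= sqrt E_{k-1} + 4 t_k eps_k ([accelerated_sqrt_step]).
    Since (k + 1) / 2 <= t_k <= k, the square roots of the energies stay below
    sqrt E_0 + 4 M, with [M] the sum of the series i eps_i, and dividing by
    t_k^2 gives the rate. *)

(** * Inner products and quadratic forms *)

Section InnerProduct.
Context {R : realType} {E F : innerType R}.
Implicit Types (x y z : E) (T S : E -> E).

Lemma dotpDl x y z : dotp (x + y) z = dotp x z + dotp y z.
Proof. exact: linearDl. Qed.

Lemma dotpDr x y z : dotp x (y + z) = dotp x y + dotp x z.
Proof. exact: linearDr. Qed.

Lemma dotpZl (a : R) x y : dotp (a *: x) y = a * dotp x y.
Proof. exact: linearZl_LR. Qed.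

Lemma dotpZr (a : R) x y : dotp x (a *: y) = a * dotp x y.
Proof. exact: linearZr_LR. Qed.

Lemma dotpNl x y : dotp (- x) y = - dotp x y.
Proof. exact: linearNl. Qed.

Lemma dotpNr x y : dotp x (- y) = - dotp x y.
Proof. exact: linearNr. Qed.

Lemma dotp0l x : dotp 0 x = 0.
Proof. exact: linear0l. Qed.

Lemma dotpC x y : dotp x y = dotp y x.
Proof. by rewrite [LHS]hermitian_subproof /= expr0 mul1r. Qed.

Lemma dotp_ge0 x : 0 <= dotp x x.
Proof.
have [->|x0] := eqVneq x 0; first by rewrite dotp0l.
exact/ltW/neq0_dnorm_gt0.
Qed.

Lemma cauchy_schwarz x y : dotp x y <= enorm x * enorm y.
Proof.
have [->|x0] := eqVneq x 0; first by rewrite dotp0l mulr_ge0 ?sqrtr_ge0.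
have xx0 : 0 < dotp x x by exact: neq0_dnorm_gt0.
rewrite /enorm -sqrtrM ?dotp_ge0// (le_trans (ler_norm _))// -sqrtr_sqr.
rewrite ler_wsqrtr//.
(* nonnegativity of the squared length of <x,x> y - <x,y> x *)
have := dotp_ge0 (dotp x x *: y + (- dotp x y) *: x).
rewrite !(dotpDl, dotpDr, dotpZl, dotpZr) (dotpC y x) => e.
by rewrite -subr_ge0 -(pmulr_rge0 _ xx0); move: e; congr (_ <= _); ring.
Qed.

Lemma sqnorm_opZ (T : {linear E -> E}) (a : R) x :
  sqnorm_op T (a *: x) = a ^+ 2 * sqnorm_op T x.
Proof. by rewrite /sqnorm_op linearZ dotpZl dotpZr mulrA -expr2. Qed.

Lemma sqnorm_opB_le (T : {linear E -> E}) x y : psd T ->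
  sqnorm_op T (x - y) <= 2 * sqnorm_op T x + 2 * sqnorm_op T y.
Proof.
move=> [saT T0]; rewrite /sqnorm_op; have := T0 (x + y).
rewrite -scaleN1r !(linearD T, linearZ_LR T, dotpDl, dotpDr, dotpZl, dotpZr).
have -> : dotp y (T x) = dotp x (T y) by rewrite -saT dotpC.
by lra.
Qed.

(** The error norm |T^{-1/2} d| is dual to the length induced by [T]. *)
Lemma dual_cauchy_schwarz T S (d z : E) : inv_sqrt_of T S ->
  dotp d z <= enorm (S d) * Num.sqrt (sqnorm_op T z).
Proof.
move=> [[saS S0] TK KT].
have -> : dotp d z = dotp (S d) (S (T z)) by rewrite saS -[in LHS](TK z).
apply: le_trans (cauchy_schwarz _ _) _.
rewrite ler_wpM2l ?sqrtr_ge0// /enorm saS.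
by have /= -> := TK z; rewrite /sqnorm_op dotpC.
Qed.
End InnerProduct.

(** * Block operators *)

Section Blocks.
Context {R : realType} {E F : innerType R}.
Implicit Types (x y z : E * F).

Lemma dotp_pair x y : dotp x y = dotp x.1 y.1 + dotp x.2 y.2.
Proof. by []. Qed.

Lemma pair_split (a : E) (b : F) : (a, b) = (a, 0) + (0, b) :> E * F.
Proof. by congr pair; rewrite /= ?addr0 ?add0r. Qed.

Variables (Q Qhat : {linear (E * F)%type -> (E * F)%type}).
Variables (D1 : {linear E -> E}) (D2 : {linear F -> F}).
Hypotheses (psdQ : psd Q) (psdD1 : psd D1) (psdD2 : psd D2).
Hypothesis QhatE : forall x, Qhat x = Q x + Diag D1 D2 x.
Let H := Diag D1 (fun v => D2 v + block22 Q v).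

Lemma sqnorm_HE x : sqnorm_op H x =
  sqnorm_op D1 x.1 + sqnorm_op D2 x.2 + sqnorm_op Q (0, x.2).
Proof.
rewrite /sqnorm_op dotp_pair /= dotpDr (dotp_pair (0, x.2)) /= dotp0l add0r.
by rewrite addrA.
Qed.

Lemma sqnorm_H_ge0 x : 0 <= sqnorm_op H x.
Proof.
rewrite sqnorm_HE; have := psdD1.2 x.1; have := psdD2.2 x.2.
by have := psdQ.2 (0, x.2); rewrite /sqnorm_op; lra.
Qed.

Lemma sqnorm_HZ (a : R) x : sqnorm_op H (a *: x) = a ^+ 2 * sqnorm_op H x.
Proof.
rewrite !sqnorm_HE /=.
have -> : (0, a *: x.2) = a *: (0, x.2) :> E * F by congr pair; rewrite scaler0.
by rewrite !sqnorm_opZ !mulrDr.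
Qed.

(** Here [y] is the displacement made by a block step and [z] what remains to the
    target.  The two inner products are the curvature parts of the slopes of the
    majorant along [z] in the two subproblems; the first one does not yet see the
    displacement of the second block. *)
Lemma block_descent_identity z y :
  2^-1 * sqnorm_op Q (z + y) - 2^-1 * sqnorm_op Qhat y
    - dotp (z.1, 0) (Qhat (y.1, 0)) - dotp (0, z.2) (Qhat y) =
  2^-1 * sqnorm_op H z - 2^-1 * sqnorm_op H (z + y)
    + 2^-1 * sqnorm_op Q (z.1, (z + y).2).
Proof.
case: z y => [z1 z2] [a b]; rewrite !sqnorm_HE /= /sqnorm_op !QhatE.
rewrite /= !dotpDr ![dotp _ (Diag _ _ _)]dotp_pair /=.
rewrite !(linear0 D1, linear0 D2) !dotp0l.
have -> : (0, z2 + b) = (0, z2) + (0, b) :> E * F.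
  by congr pair; rewrite /= addr0.
have -> : (z1, z2 + b) = (z1, 0) + (0, z2) + (0, b) :> E * F.
  by congr pair; rewrite /= ?addr0 ?add0r.
rewrite (pair_split z1 z2) (pair_split a b).
have saD1 : dotp a (D1 z1) = dotp z1 (D1 a) by rewrite -psdD1.1 dotpC.
have saD2 : dotp b (D2 z2) = dotp z2 (D2 b) by rewrite -psdD2.1 dotpC.
have saQ x y : dotp x (Q y) = dotp y (Q x) by rewrite -psdQ.1 dotpC.
have dE (x y : E * F) : prod_dot x y = dotp x y by [].
rewrite !dE !(linearD Q, linearD D1, linearD D2, dotpDl, dotpDr) saD1 saD2.
rewrite (saQ (0, z2) (z1, 0)) (saQ (a, 0) (z1, 0)) (saQ (0, b) (z1, 0)).
rewrite (saQ (a, 0) (0, z2)) (saQ (0, b) (0, z2)) (saQ (0, b) (a, 0)).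
by field.
Qed.

(** Writing (y_u, 0) = (y_u, x_v) - (0, x_v) bounds the [Q]-part of the first
    block, which the [H]-length of [y] alone does not see. *)
Lemma sqnorm_block11_le x y :
  sqnorm_op (block11 Qhat) y.1 <=
    sqnorm_op H y + 2 * sqnorm_op Q (y.1, x.2) + 2 * sqnorm_op H x.
Proof.
have -> : sqnorm_op (block11 Qhat) y.1 =
    sqnorm_op Q (y.1, 0) + sqnorm_op D1 y.1.
  by rewrite /sqnorm_op /block11 QhatE dotpDr dotp_pair /= dotp0l addr0.
have -> : (y.1, 0) = (y.1, x.2) - (0, x.2) :> E * F.
  by congr pair; rewrite /= ?subr0 ?subrr.
have := sqnorm_opB_le (y.1, x.2) (0, x.2) psdQ; rewrite !sqnorm_HE.
have := psdD2.2 y.2; have := psdQ.2 (0, y.2); have := psdD1.2 x.1.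
have := psdD2.2 x.2; rewrite /sqnorm_op; lra.
Qed.

Lemma sqnorm_block22_le y : sqnorm_op (block22 Qhat) y.2 <= sqnorm_op H y.
Proof.
rewrite /sqnorm_op /block22 QhatE dotpDr dotp_pair /= dotpDr.
by rewrite [leRHS]addrC [dotp _ _ + dotp _ _]addrC lerDl psdD1.2.
Qed.
End Blocks.

(** * Convex functions with extended real values *)

Section ExtendedConvexity.
Context {R : realType}.

Lemma fine_convex (E : lmodType R) (f : E -> \bar R) (x y : E) (s : R) :
  (forall z, f z != -oo%E) -> convex_ereal f ->
  f x \is a fin_num -> f y \is a fin_num -> 0 <= s <= 1 ->
  f (s *: x + (1 - s) *: y) \is a fin_num /\
  fine (f (s *: x + (1 - s) *: y)) <= s * fine (f x) + (1 - s) * fine (f y).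
Proof.
move=> fN cf fx fy s01; have := cf x y s s01.
rewrite -(fineK fx) -(fineK fy) -!EFinM -EFinD /=.
have := fN (s *: x + (1 - s) *: y); case: (f _) => [r||] //=.
Qed.

Lemma sep_sum_neqNy (X Y : Type) (f : X -> \bar R) (g : Y -> \bar R) :
  (forall x, f x != -oo%E) -> (forall y, g y != -oo%E) ->
  forall z, sep_sum f g z != -oo%E.
Proof.
move=> fN gN [x y]; rewrite /sep_sum /=.
by have := fN x; have := gN y; case: (f x) => [r||]; case: (g y) => [r'||].
Qed.

Lemma sep_sum_convex (E F : lmodType R) (f : E -> \bar R) (g : F -> \bar R) :
  (forall x, f x != -oo%E) -> (forall y, g y != -oo%E) ->
  convex_ereal f -> convex_ereal g -> convex_ereal (sep_sum f g).
Proof.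
move=> fN gN cf cg [x1 x2] [y1 y2] s s01; rewrite /sep_sum /=.
apply: le_trans (leeD (cf _ _ _ s01) (cg _ _ _ s01)) _.
have dom u v : u != -oo%E -> v != -oo%E -> (u +? v :> bool)%E.
  by case: u => [?||]; case: v => [?||].
by rewrite !muleDr ?dom ?fN ?gN//= addeACA.
Qed.

(** First-order condition at a minimizer of [f + m], for [m] quadratic along the
    direction [d] with slope [l] at [y]. *)
Lemma argmin_variation (E : lmodType R) (f : E -> \bar R) (m : E -> R)
    (y d : E) (l c : R) :
  (forall x, f x != -oo%E) -> convex_ereal f ->
  f y \is a fin_num -> f (y + d) \is a fin_num ->
  (forall s, m (y + s *: d) = m y + s * l + s ^+ 2 * c) ->
  y \in argmin (fun x => (f x + (m x)%:E)%E) ->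
  fine (f y) <= fine (f (y + d)) + l.
Proof.
move=> fN cf fy fyd mE; rewrite inE => ymin.
set A := fine (f y); set B := fine (f (y + d)).
have ineq s : 0 < s <= 1 -> A - B - l <= s * c.
  move=> /andP[s0 s1]; have s01 : 0 <= s <= 1 by rewrite ltW.
  have [zfin zle] := fine_convex fN cf fyd fy s01.
  have zE : s *: (y + d) + (1 - s) *: y = y + s *: d.
    by rewrite scalerDr scalerBl scale1r addrAC addrCA subrr addr0.
  move: zfin zle; rewrite zE => zfin zle.
  have := ymin (y + s *: d); rewrite -(fineK zfin) -(fineK fy) -!EFinD lee_fin.
  rewrite mE -/A => ysle; rewrite -(ler_pM2l s0).
  move: zle ysle; rewrite -/A -/B; nra.
rewrite -lerBlDl -subr_le0 leNgt; apply/negP => gap.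
have := ineq 1; have [c0|c0] := leP c 0; first by rewrite ltr01 lexx; lra.
set g := A - B - l in gap ineq *.
have gE : A - B - l = g by [].
(* the perturbation s = gap / (2 c) contradicts the bound *)
have s0 : 0 < g / (2 * c) by rewrite divr_gt0 ?mulr_gt0.
move=> /(_ _); rewrite ltr01 lexx mul1r => /(_ isT) gc.
have := ineq (g / (2 * c)); rewrite s0 ler_pdivrMr ?mulr_gt0// => /(_ _).
have -> : g / (2 * c) * c = g / 2 by field; rewrite gt_eqF.
lra.
Qed.

Lemma argmin_fin_num (X : Type) (f : X -> \bar R) (m : X -> R) (x y : X) :
  (forall z, f z != -oo%E) -> (f x < +oo)%E ->
  y \in argmin (fun z => (f z + (m z)%:E)%E) -> f y \is a fin_num.
Proof.
move=> fN fx; rewrite inE => /(_ x); have := fN y; have := fN x; move: fx.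
by case: (f x) => [r||]; case: (f y) => [r'||].
Qed.

Lemma convex_functionT_le (E : lmodType R) (h : E -> R) (x y : E) (s : R) :
  convex_function setT h -> 0 <= s <= 1 ->
  h (s *: x + (1 - s) *: y) <= s * h x + (1 - s) * h y.
Proof.
move=> ch s01.
have := ch (Itv01 (andP s01).1 (andP s01).2) x y (in_setT _) (in_setT _).
by [].
Qed.
End ExtendedConvexity.

(** * Scalar recursions *)

Section Bounds.
Context {R : realType}.

(** The third clause, t_{k+1}^2 - t_{k+1} = t_k^2, is what makes the weights of the
    energy telescope. *)
Lemma accel_param_bounds (t : nat -> R) : t 1%N = 1 ->
  (forall k, (1 <= k)%N -> t k.+1 = 2^-1 * (1 + Num.sqrt (1 + 4 * t k ^+ 2))) ->
  forall k, [/\ (k%:R + 2) / 2 <= t k.+1, t k.+1 <= k%:R + 1 &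
    t k.+2 ^+ 2 - t k.+2 = t k.+1 ^+ 2].
Proof.
move=> t1 tS.
have bounds k : (k%:R + 2) / 2 <= t k.+1 /\ t k.+1 <= k%:R + 1.
  elim: k => [|k [lo hi]]; first by rewrite t1; lra.
  have k0 : 0 <= k%:R :> R by [].
  rewrite -(natr1 k) tS//.
  set x := t k.+1 in lo hi *; have x0 : 0 <= x by lra.
  have lo' : 2 * x <= Num.sqrt (1 + 4 * x ^+ 2).
    rewrite -[leLHS]ger0_norm ?mulr_ge0// -sqrtr_sqr ler_wsqrtr// exprMn.
    by rewrite -natrX; lra.
  have hi' : Num.sqrt (1 + 4 * x ^+ 2) <= 1 + 2 * x.
    rewrite -[leRHS]ger0_norm ?addr_ge0 ?mulr_ge0// -sqrtr_sqr ler_wsqrtr//.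
    by have := x0; nra.
  by split; lra.
move=> k; have [lo hi] := bounds k; split => //.
rewrite (tS k.+1)//; set x := t k.+1.
have s2 : Num.sqrt (1 + 4 * x ^+ 2) ^+ 2 = 1 + 4 * x ^+ 2.
  by rewrite sqr_sqrtr// addr_ge0// mulr_ge0// sqr_ge0.
set s := Num.sqrt _ in s2 *.
have -> : (2^-1 * (1 + s)) ^+ 2 - 2^-1 * (1 + s) = 4^-1 * (s ^+ 2 - 1) by field.
by rewrite s2; field.
Qed.

(** Factor F - e = (sqrt F - sqrt e) (sqrt F + sqrt e) and use
    sqrt (F + e) <= sqrt F + sqrt e. *)
Lemma sqrt_recursion_step (F e s : R) :
  0 <= F -> 0 <= e -> 0 <= s ->
  F <= e + s * Num.sqrt (F + e) -> Num.sqrt F <= Num.sqrt e + s.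
Proof.
move=> F0 e0 s0 key.
have bF := sqrtr_ge0 F; have be := sqrtr_ge0 e.
have sFe : Num.sqrt (F + e) <= Num.sqrt F + Num.sqrt e.
  rewrite -(@ler_pXn2r _ 2) ?nnegrE ?addr_ge0 ?sqrtr_ge0//.
  rewrite sqr_sqrtr ?addr_ge0// sqrrD !sqr_sqrtr//.
  by have := mulr_ge0 bF be; lra.
have aF := sqr_sqrtr F0; have ae := sqr_sqrtr e0.
set a := Num.sqrt F in aF bF sFe *; set b := Num.sqrt e in ae be sFe *.
rewrite leNgt; apply/negP => lt.
have le1 := ler_wpM2l s0 sFe.
have : s * (a + b) < (a - b) * (a + b) by rewrite ltr_pM2r; lra.
have -> : (a - b) * (a + b) = F - e by rewrite -aF -ae; ring.
lra.
Qed.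

Lemma sqrt_recursion_bound (E s : nat -> R) :
  (forall k, Num.sqrt (E k.+1) <= Num.sqrt (E k) + 4 * s k.+1) ->
  forall n, Num.sqrt (E n) <= Num.sqrt (E 0%N) + 4 * \sum_(1 <= i < n.+1) s i.
Proof.
move=> step; elim=> [|n ih]; first by rewrite big_nil mulr0 addr0.
by rewrite big_nat_recr//=; have := step n; lra.
Qed.

Lemma partial_sums_bounded (u : nat -> R) : (forall i, (1 <= i)%N -> 0 <= u i) ->
  (\sum_(1 <= i <oo) (u i)%:E < +oo)%E ->
  exists2 M, 0 <= M & forall n, \sum_(1 <= i < n) u i <= M.
Proof.
move=> u0 fin; set S := (\sum_(1 <= i <oo) (u i)%:E)%E in fin.
have u0' i : (1 <= i)%N -> true -> (0 <= (u i)%:E)%E.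
  by move=> i1 _; rewrite lee_fin u0.
have S0 : (0 <= S)%E by exact: nneseries_ge0.
have Sfin : S \is a fin_num by rewrite ge0_fin_numE.
exists (fine S) => [|n]; first exact: fine_ge0.
rewrite -lee_fin fineK// -sumEFin; exact: nneseries_lim_ge.
Qed.
End Bounds.

(** * One inexact accelerated step *)

Section Step.
Context {R : realType} {U V : innerType R}.
Local Notation W := (U * V)%type.
Variables (h : W -> R) (g : W -> W) (p : U -> \bar R) (q : V -> \bar R).
Variables (Q Qhat : {linear W -> W}) (D1 : {linear U -> U}) (D2 : {linear V -> V}).
Let H := Diag D1 (fun v => D2 v + block22 Q v).

(** The quadratic model of [h] at [y] with curvature [T]. *)
Definition qmodel (T : W -> W) (x y : W) : R :=
  h y + dotp (g y) (x - y) + 2^-1 * sqnorm_op T (x - y).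

(** The objective as a real number; it is meaningful on the domain of [p] and [q]
    only, since [fine] sends infinite values to 0. *)
Definition theta_fin (x : W) : R := h x + fine (p x.1) + fine (q x.2).

Lemma qmodel_line (T : {linear W -> W}) (x d y : W) (s : R) : self_adjoint T ->
  qmodel T (x + s *: d) y = qmodel T x y
    + s * (dotp (g y) d + dotp d (T (x - y))) + s ^+ 2 * (2^-1 * sqnorm_op T d).
Proof.
move=> saT; rewrite /qmodel /sqnorm_op addrAC.
rewrite !(linearD T, linearZ_LR T, dotpDl, dotpDr, dotpZl, dotpZr).
rewrite !(dotpC d (T _)) !saT; by field.
Qed.

Hypotheses (pN : forall u, p u != -oo%E) (qN : forall v, q v != -oo%E).
Hypotheses (cp : convex_ereal p) (cq : convex_ereal q).
Hypothesis ch : forall (x y : W) (s : R), 0 <= s <= 1 ->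
  h (s *: x + (1 - s) *: y) <= s * h x + (1 - s) * h y.
Hypotheses (psdQ : psd Q) (psdQhat : psd Qhat) (psdD1 : psd D1) (psdD2 : psd D2).
Hypothesis QhatE : forall x, Qhat x = Q x + Diag D1 D2 x.
Hypothesis minor : forall x y, qmodel Q x y <= h x.
Hypothesis major : forall x y, h x <= qmodel Qhat x y.

(** Membership in the product of the domains of [p] and [q]. *)
Definition in_dom (x : W) := (p x.1 \is a fin_num) /\ (q x.2 \is a fin_num).

(** [y] is obtained from [x] by minimizing the perturbed majorant in the first
    block, then in the second block at the new first block. *)
Definition inexact_step (d x y : W) :=
  y.1 \in argmin (fun u : U =>
       (p u + (qmodel Qhat (u, x.2) x + dotp d.1 u)%:E)%E)
  /\ y.2 \in argmin (fun v : V =>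
       (q v + (qmodel Qhat (y.1, v) x + dotp d.2 v)%:E)%E).

Lemma step_descent (d x y z : W) : inexact_step d x y -> in_dom y -> in_dom z ->
  theta_fin y + 2^-1 * sqnorm_op H (z - y)
    + 2^-1 * sqnorm_op Q ((z - y).1, (z - x).2) <=
  theta_fin z + 2^-1 * sqnorm_op H (z - x) + dotp d (z - y).
Proof.
case=> yu yv [py qy] [pz qz].
have zE1 : y.1 + (z - y).1 = z.1 by rewrite /= addrC subrK.
have zE2 : y.2 + (z - y).2 = z.2 by rewrite /= addrC subrK.
have vu : fine (p y.1) <= fine (p z.1) +
    (dotp (g x) ((z - y).1, 0) + dotp ((z - y).1, 0) (Qhat ((y - x).1, 0))
     + dotp d.1 (z - y).1).
  rewrite -zE1; apply: (@argmin_variation _ _ _ _ _ _ _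
    (2^-1 * sqnorm_op Qhat ((z - y).1, 0)) pN cp py _ _ yu); first by rewrite zE1.
  move=> s; have -> : (y.1 + s *: (z - y).1, x.2) =
      (y.1, x.2) + s *: ((z - y).1, 0) :> W.
    by congr pair; rewrite /= scaler0 addr0.
  rewrite qmodel_line; last exact: psdQhat.1.
  have -> : (y.1, x.2) - x = ((y - x).1, 0) by congr pair; rewrite /= subrr.
  rewrite dotpDr dotpZr; move: (qmodel _ _ _) (2^-1 * _) (dotp d.1 y.1).
  by move: (dotp (g x) _) (dotp _ (Qhat _)) (dotp d.1 _) => *; ring.
have vv : fine (q y.2) <= fine (q z.2) +
    (dotp (g x) (0, (z - y).2) + dotp (0, (z - y).2) (Qhat (y - x))
     + dotp d.2 (z - y).2).
  rewrite -zE2; apply: (@argmin_variation _ _ _ _ _ _ _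
    (2^-1 * sqnorm_op Qhat (0, (z - y).2)) qN cq qy _ _ yv); first by rewrite zE2.
  move=> s; have -> : (y.1, y.2 + s *: (z - y).2) = y + s *: (0, (z - y).2).
    by congr pair; rewrite /= scaler0 addr0.
  rewrite -surjective_pairing qmodel_line; last exact: psdQhat.1.
  rewrite dotpDr dotpZr; move: (qmodel _ _ _) (2^-1 * _) (dotp d.2 y.2).
  by move: (dotp (g x) _) (dotp _ (Qhat _)) (dotp d.2 _) => *; ring.
have gE : dotp (g x) (z - x) = dotp (g x) (y - x)
    + dotp (g x) ((z - y).1, 0) + dotp (g x) (0, (z - y).2).
  rewrite -addrA -dotpDr -(pair_split (z - y).1 (z - y).2).
  by rewrite -surjective_pairing -dotpDr (addrC (y - x)) addrA subrK.
have := block_descent_identity psdQ psdD1 psdD2 QhatE (z - y) (y - x).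
have zxE : z - y + (y - x) = z - x by rewrite addrA subrK.
rewrite zxE -/H; have := minor z x; have := major y x.
move: vu vv gE; rewrite /qmodel /theta_fin (dotp_pair d); lra.
Qed.

Lemma theta_fin_convex (x y : W) (s : R) : in_dom x -> in_dom y -> 0 <= s <= 1 ->
  in_dom (s *: x + (1 - s) *: y) /\
  theta_fin (s *: x + (1 - s) *: y) <= s * theta_fin x + (1 - s) * theta_fin y.
Proof.
move=> [px qx] [py qy] s01.
have [pf ple] := fine_convex pN cp px py s01.
have [qf qle] := fine_convex qN cq qx qy s01.
split; first by split.
have := ch x y s01; move: ple qle; rewrite /theta_fin /=; lra.
Qed.

(** [step_descent] at the target [(ys + (t - 1) yp) / t], multiplied by [t ^+ 2]. *)
Lemma accelerated_descent (d x y yp ys : W) (t : R)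
    (X := t *: x - (t - 1) *: yp - ys) (Z := t *: y - (t - 1) *: yp - ys) :
  inexact_step d x y -> in_dom y -> in_dom yp -> in_dom ys -> 1 <= t ->
  t ^+ 2 * (theta_fin y - theta_fin ys) + 2^-1 * sqnorm_op H Z
    + 2^-1 * sqnorm_op Q (Z.1, X.2) <=
  (t ^+ 2 - t) * (theta_fin yp - theta_fin ys) + 2^-1 * sqnorm_op H X
    + t * dotp d (- Z).
Proof.
move=> st dy dyp dys t1; have t0 : 0 < t by lra.
have tn0 : t != 0 by rewrite gt_eqF.
have s01 : 0 <= t^-1 <= 1 by rewrite invr_ge0 ltW//= invf_le1.
have [dz zle] := theta_fin_convex dys dyp s01.
set z := t^-1 *: ys + (1 - t^-1) *: yp in dz zle.
have zX a : t *: (z - a) = - (t *: a - (t - 1) *: yp - ys).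
  rewrite scalerBr scalerDr !scalerA mulfV// mulrBr mulr1 mulfV// scale1r.
  by rewrite !opprD !opprK addrC (addrC ys) addrA.
have zyE : z - y = (- t^-1) *: Z.
  by rewrite -(opprK Z) -zX scalerN scaleNr opprK scalerA mulVf// scale1r.
have zxE : z - x = (- t^-1) *: X.
  by rewrite -(opprK X) -zX scalerN scaleNr opprK scalerA mulVf// scale1r.
have := step_descent st dy dz; rewrite zyE zxE.
have -> : (((- t^-1) *: Z).1, ((- t^-1) *: X).2) = (- t^-1) *: (Z.1, X.2) by [].
rewrite !(sqnorm_HZ Q D1 D2) sqnorm_opZ dotpZr dotpNr sqrrN => le1.
have le2 := le_trans le1 (lerD (lerD zle (lexx _)) (lexx _)).
have t20 : 0 < t ^+ 2 by rewrite exprn_gt0.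
rewrite -(ler_pM2l t20) in le2.
set Hx := sqnorm_op H X in le2 *; set Hz := sqnorm_op H Z in le2 *.
set Qz := sqnorm_op Q _ in le2 *; set a := dotp d Z in le2 *.
set Ty := theta_fin y in le2 *; set Ts := theta_fin ys in le2 *.
set Tp := theta_fin yp in le2 *.
have e1 : t ^+ 2 * (Ty + 2^-1 * (t^-1 ^+ 2 * Hz) + 2^-1 * (t^-1 ^+ 2 * Qz)) =
  t ^+ 2 * Ty + 2^-1 * Hz + 2^-1 * Qz by field.
have e2 : t ^+ 2 * (t^-1 * Ts + (1 - t^-1) * Tp + 2^-1 * (t^-1 ^+ 2 * Hx)
   + - t^-1 * a) = t * Ts + (t ^+ 2 - t) * Tp + 2^-1 * Hx - t * a by field.
by move: le2; rewrite e1 e2; lra.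
Qed.

(** With [e] and [e'] the energies before and after the step, the square root of
    the energy grows by at most [4 * (t * eps)]. *)
Lemma accelerated_sqrt_step (S1 : U -> U) (S2 : V -> V) (d x y yp ys : W)
    (t eps : R)
    (X := t *: x - (t - 1) *: yp - ys) (Z := t *: y - (t - 1) *: yp - ys)
    (e := (t ^+ 2 - t) * (theta_fin yp - theta_fin ys) + 2^-1 * sqnorm_op H X)
    (e' := t ^+ 2 * (theta_fin y - theta_fin ys) + 2^-1 * sqnorm_op H Z) :
  inv_sqrt_of (block11 Qhat) S1 -> inv_sqrt_of (block22 Qhat) S2 ->
  inexact_step d x y -> in_dom y -> in_dom yp -> in_dom ys -> 1 <= t ->
  theta_fin ys <= theta_fin yp -> theta_fin ys <= theta_fin y ->
  enorm (S1 d.1) <= eps -> enorm (S2 d.2) <= eps ->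
  Num.sqrt e' <= Num.sqrt e + 4 * (t * eps).
Proof.
move=> S1P S2P st dy dyp dys t1 yps yys d1 d2.
have := accelerated_descent st dy dyp dys t1; rewrite -/X -/Z -/e -/e'.
set P := 2^-1 * sqnorm_op Q _ => desc.
have P0 : 0 <= P by rewrite mulr_ge0 ?invr_ge0//; exact: psdQ.2.
have HX0 := sqnorm_H_ge0 psdQ psdD1 psdD2 X.
have HZ0 := sqnorm_H_ge0 psdQ psdD1 psdD2 Z.
rewrite -/H in HX0 HZ0.
have e0 : sqnorm_op H X <= 2 * e.
  suff : 0 <= (t ^+ 2 - t) * (theta_fin yp - theta_fin ys) by rewrite /e; lra.
  by rewrite mulr_ge0 ?subr_ge0// expr2 ler_peMl//; lra.
have e'0 : sqnorm_op H Z <= 2 * e'.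
  suff : 0 <= t ^+ 2 * (theta_fin y - theta_fin ys) by rewrite /e'; lra.
  by rewrite mulr_ge0 ?subr_ge0// sqr_ge0.
have A1 := sqnorm_block11_le psdQ psdD1 psdD2 QhatE X Z.
have A2 := sqnorm_block22_le psdD1 QhatE Z.
rewrite -/H in A1 A2.
have eps0 : 0 <= eps by apply: le_trans d1; exact: sqrtr_ge0.
pose F := e' + P.
(* both block lengths are at most twice sqrt (F + e) *)
have r4 c : c <= 4 * (F + e) -> Num.sqrt c <= 2 * Num.sqrt (F + e).
  move=> cle; apply: (le_trans (ler_wsqrtr cle)).
  have -> : 4 * (F + e) = 2 ^+ 2 * (F + e) by ring.
  by rewrite sqrtrM ?sqr_ge0// sqrtr_sqr ger0_norm.
have r1 : Num.sqrt (sqnorm_op (block11 Qhat) Z.1) <= 2 * Num.sqrt (F + e).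
  by apply: r4; apply: (le_trans A1); rewrite /F /P; lra.
have r2 : Num.sqrt (sqnorm_op (block22 Qhat) Z.2) <= 2 * Num.sqrt (F + e).
  by apply: r4; apply: (le_trans A2); rewrite /F; lra.
have dZ : dotp d (- Z) <= eps * (4 * Num.sqrt (F + e)).
  have N1 : sqnorm_op (block11 Qhat) (- Z).1 = sqnorm_op (block11 Qhat) Z.1.
    rewrite /sqnorm_op /block11 /= dotpNl.
    have -> : (- Z.1, 0) = - (Z.1, 0) :> W by congr pair; rewrite /= oppr0.
    by rewrite linearN /= dotpNr opprK.
  have N2 : sqnorm_op (block22 Qhat) (- Z).2 = sqnorm_op (block22 Qhat) Z.2.
    rewrite /sqnorm_op /block22 /= dotpNl.
    have -> : (0, - Z.2) = - (0, Z.2) :> W by congr pair; rewrite /= oppr0.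
    by rewrite linearN /= dotpNr opprK.
  have := dual_cauchy_schwarz d.1 (- Z).1 S1P.
  have := dual_cauchy_schwarz d.2 (- Z).2 S2P; rewrite N1 N2 => c2 c1.
  have c1' := le_trans c1 (ler_pM (sqrtr_ge0 _) (sqrtr_ge0 _) d1 r1).
  have c2' := le_trans c2 (ler_pM (sqrtr_ge0 _) (sqrtr_ge0 _) d2 r2).
  by rewrite dotp_pair; lra.
have F0 : 0 <= F by rewrite /F; lra.
have ee0 : 0 <= e by lra.
have key : F <= e + 4 * (t * eps) * Num.sqrt (F + e).
  have t0 : 0 <= t by lra.
  have := ler_wpM2l t0 dZ; rewrite /F; lra.
apply: (@le_trans _ _ (Num.sqrt F)); first by rewrite ler_wsqrtr// /F; lra.
have s0 : 0 <= t * eps by rewrite mulr_ge0//; lra.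
by apply: sqrt_recursion_step => //; rewrite mulr_ge0.
Qed.
End Step.

(** * The convergence rate *)

Theorem theorem3 (R : realType) (U1 U2 V1 V2 : euclideanType R)
  (h : (U1 * U2) * (V1 * V2) -> R)
  (gradh : (U1 * U2) * (V1 * V2) -> (U1 * U2) * (V1 * V2))
  (phi1 : U1 -> \bar R) (phi2 : U2 -> \bar R)
  (phi3 : V1 -> \bar R) (phi4 : V2 -> \bar R)
  (Q Qhat : {linear ((U1 * U2) * (V1 * V2))%type -> ((U1 * U2) * (V1 * V2))%type})
  (D1 : {linear (U1 * U2)%type -> (U1 * U2)%type})
  (D2 : {linear (V1 * V2)%type -> (V1 * V2)%type})
  (S1 : {linear (U1 * U2)%type -> (U1 * U2)%type})
  (S2 : {linear (V1 * V2)%type -> (V1 * V2)%type})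
  (eps t : nat -> R) (du : nat -> U1 * U2) (dv : nat -> V1 * V2)
  (w wt : nat -> (U1 * U2) * (V1 * V2)) (wstar : (U1 * U2) * (V1 * V2))
  (p := sep_sum phi1 phi2) (q := sep_sum phi3 phi4)
  (H := Diag D1 (fun v => D2 v + block22 Q v)) :
  convex_function setT h ->
  gradient_of h gradh ->
  (exists L : R, forall x y, enorm (gradh x - gradh y) <= L * enorm (x - y)) ->
  proper_closed_convex phi1 -> proper_closed_convex phi2 ->
  proper_closed_convex phi3 -> proper_closed_convex phi4 ->
  psd Q -> psd Qhat ->
  (forall x y, quad_model h gradh Q x y <= h x) ->
  (forall x y, h x <= quad_model h gradh Qhat x y) ->
  psd D1 -> psd D2 ->
  (forall x, Qhat x = Q x + Diag D1 D2 x) ->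
  pd (block11 Qhat) -> pd (block22 Qhat) ->
  inv_sqrt_of (block11 Qhat) S1 -> inv_sqrt_of (block22 Qhat) S2 ->
  wstar \in argmin (theta h p q) ->
  imABCD p q (quad_model h gradh Qhat) S1 S2 eps t du dv w wt ->
  (\sum_(1 <= i <oo) (i%:R * eps i)%:E < +oo)%E ->
  exists c0 : R, 0 < c0 /\
    forall k, (1 <= k)%N ->
      (theta h p q (wt k) - theta h p q wstar <=
        ((2 * sqnorm_op H (wt 0%N - wstar) + c0) / (k + 1)%:R ^+ 2)%:E)%E.
Proof.
move=> ch _ _ [[f1N [_ _]] _ c1] [[f2N [_ _]] _ c2] [[f3N [_ _]] _ c3]
  [[f4N [_ _]] _ c4].
move=> psdQ psdQhat minor major psdD1 psdD2 QhatE _ _ S1P S2P wsmin alg sumfin.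
have pN : forall u, p u != -oo%E by exact: sep_sum_neqNy.
have qN : forall v, q v != -oo%E by exact: sep_sum_neqNy.
have cp : convex_ereal p by exact: sep_sum_convex.
have cq : convex_ereal q by exact: sep_sum_convex.
have chR := convex_functionT_le _ _ ch.
case: alg => w1 [p0 q0] eps0 _ t1 argu argv err tS wS.
have dom k : in_dom p q (wt k).
  case: k => [|k]; first by split; rewrite fin_numE ?pN ?qN lt_eqF.
  by split; [exact: (argmin_fin_num pN p0 (argu k.+1 isT))
            |exact: (argmin_fin_num qN q0 (argv k.+1 isT))].
have thetaE z : in_dom p q z -> theta h p q z = (theta_fin h p q z)%:E.
  by case=> pz qz; rewrite /theta -(fineK pz) -(fineK qz).
have wsle k := (set_mem wsmin) (wt k).
have doms : in_dom p q wstar.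
  have := wsle 0%N; rewrite (thetaE _ (dom 0%N)) /theta /in_dom.
  have := pN wstar.1; have := qN wstar.2.
  by case: (p wstar.1) => [?||]; case: (q wstar.2)=> [?||].
have Tle k : theta_fin h p q wstar <= theta_fin h p q (wt k).
  by rewrite -lee_fin -!thetaE.
set T := theta_fin h p q in thetaE Tle.
pose X k := t k *: w k - (t k - 1) *: wt k.-1 - wstar.
(* For k >= 1 the weight below is t_k^2; at k = 0 it vanishes, so that E 0 carries
   no objective gap. *)
pose E k := (t k.+1 ^+ 2 - t k.+1) * (T (wt k) - T wstar)
  + 2^-1 * sqnorm_op H (X k.+1).
have tb := accel_param_bounds t1 tS.
have tge1 k : 1 <= t k.+1.
  by have [lo _ _] := tb k; have : 0 <= k%:R :> R by []; lra.
have XS k : X k.+2 = t k.+1 *: wt k.+1 - (t k.+1 - 1) *: wt k - wstar.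
  rewrite /X wS//=; congr (_ - _).
  have tn0 : t k.+2 != 0 by rewrite gt_eqF// (lt_le_trans _ (tge1 k.+1)).
  rewrite scalerDr scalerA mulrCA mulfV// mulr1 scalerBr !(scalerBl _ _ (wt k.+1)).
  rewrite !scale1r (opprB (_ *: _)) addrC addrA subrK addrA (addrC (wt k.+1)).
  by rewrite subrK.
have ES k : E k.+1 = t k.+1 ^+ 2 * (T (wt k.+1) - T wstar)
    + 2^-1 * sqnorm_op H (t k.+1 *: wt k.+1 - (t k.+1 - 1) *: wt k - wstar).
  by rewrite /E XS; have [_ _ ->] := tb k.
have step k : Num.sqrt (E k.+1) <= Num.sqrt (E k) + 4 * (k.+1%:R * eps k.+1).
  have [d1 d2] : enorm (S1 (du k.+1)) <= eps k.+1 /\ enorm (S2 (dv k.+1)) <= eps k.+1.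
    by have := err k.+1 isT; rewrite ge_max => /andP.
  have st : inexact_step h gradh p q Qhat (du k.+1, dv k.+1) (w k.+1) (wt k.+1).
    by split; [exact: argu|exact: argv].
  rewrite ES; apply: (le_trans (accelerated_sqrt_step pN qN cp cq chR psdQ psdQhat
    psdD1 psdD2 QhatE minor major S1P S2P st (dom _) (dom k) doms (tge1 k)
    (Tle k) (Tle _) d1 d2)).
  rewrite lerD2l ler_wpM2l// ler_wpM2r ?eps0//.
  by have [_ hi _] := tb k; rewrite -natr1.
have [||M M0 sumM] := @partial_sums_bounded _ (fun i => i%:R * eps i).
- by move=> i i1; rewrite mulr_ge0// eps0.
- exact: sumfin.
have E0E : E 0%N = 2^-1 * sqnorm_op H (wt 0%N - wstar).
  rewrite /E /X t1 w1 expr1n subrr mul0r add0r scale1r scale0r subr0.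
  by [].
have E00 : 0 <= E 0%N.
  by rewrite E0E mulr_ge0 ?invr_ge0//; exact: sqnorm_H_ge0.
have rE n : Num.sqrt (E n) <= Num.sqrt (E 0%N) + 4 * M.
  apply: (le_trans (sqrt_recursion_bound (s:= fun i => i%:R * eps i) step n)).
  by rewrite lerD2l ler_wpM2l//.
(* 4 (sqrt (E 0) + 4 M)^2 = 2 |wt_0 - w*|_H^2 + 4 (8 M sqrt (E 0) + 16 M^2);
   adding 1 keeps the constant positive when M = 0. *)
exists (4 * (8 * M * Num.sqrt (E 0%N) + 16 * M ^+ 2) + 1); split.
  have := mulr_ge0 M0 (sqrtr_ge0 (E 0%N)); have := sqr_ge0 M; lra.
case=> // k _; rewrite !thetaE// -EFinB lee_fin.
have [lo _ _] := tb k; have k0 : 0 <= k%:R :> R by [].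
have gap0 : 0 <= T (wt k.+1) - T wstar by rewrite subr_ge0.
have HX0 : 0 <= sqnorm_op H (X k.+2) by exact: sqnorm_H_ge0.
have gapE : t k.+1 ^+ 2 * (T (wt k.+1) - T wstar) <= E k.+1.
  by rewrite ES -XS; lra.
have Ek0 : 0 <= E k.+1 by apply: le_trans gapE; rewrite mulr_ge0// sqr_ge0.
have Ele : E k.+1 <= (Num.sqrt (E 0%N) + 4 * M) ^+ 2.
  rewrite -[leLHS](sqr_sqrtr Ek0) ler_pXn2r ?nnegrE ?sqrtr_ge0//.
  by rewrite addr_ge0 ?sqrtr_ge0 ?mulr_ge0.
rewrite ler_pdivlMr ?exprn_gt0 ?ltr0n ?addn1//.
have e0 := sqr_sqrtr E00; rewrite [RHS]E0E in e0.
set s := Num.sqrt _ in e0 Ele *.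
have tsq : (k.+2)%:R ^+ 2 <= 4 * t k.+1 ^+ 2.
  have -> : k.+2%:R = k%:R + 2 :> R by rewrite -addn2 natrD.
  nra.
have := ler_wpM2l gap0 tsq; nra.
Qed.
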